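(* Assume that $F:\mathbb{R}^d\to\mathbb{R}$ is $M$-smooth. For $h>0$ and $s\in\mathbb{N}$ let $$g^{\mathrm G}_{h,s}(x)=\frac1s\sum_{i=1}^s\frac{F(x+hu_i)-F(x)}{h}\,u_i,\qquad u_1,\dots,u_s\sim\mathcal N(0,I_d)\ \text{independent},$$ and assume $h\le1$. Then, for every $x\in\mathbb{R}^d$, $$\mathbb{E}\left[\big\|g^{\mathrm G}_{h,s}(x)-\nabla F(x)\big\|^2\right]\le\delta_{\mathrm G}\left(P_{\mathrm G}\|x\|^2+Q_{\mathrm G}\right),$$ where $$\delta_{\mathrm G}:=\frac{d(d+2)}{s}+d(d+2)(d+4)h^2,$$ and $P_{\mathrm G},Q_{\mathrm G}$ are constants independent of $d,\beta,\gamma,h,s$. In particular, the controlled-growth condition on the gradient error holds for $g^{\mathrm G}_{h,s}$ with $\delta=\delta_{\mathrm G}$, $P=P_{\mathrm G}$ and $Q=Q_{\mathrm G}$.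
   Context: $M$-smooth: $F$ is continuously differentiable and $\|\nabla F(x)-\nabla F(y)\|\le M\|x-y\|$ for all $x,y\in\mathbb{R}^d$. Standing assumption where the lemma appears: $F$ is also $(m,b)$-dissipative, i.e. $\langle x,\nabla F(x)\rangle\ge m\|x\|^2-b$ for all $x\in\mathbb{R}^d$, with constants $m,b>0$. Controlled-growth condition for a random surrogate $g(x,\xi)$ of $\nabla F(x)$: there exist non-negative constants $P,Q$ and a precision parameter $\delta>0$ such that $\mathbb{E}\big[\|g(x,\xi)-\nabla F(x)\|^2\big]\le\delta(P\|x\|^2+Q)$ for all $x\in\mathbb{R}^d$; $g$ is not required to be unbiased. $\beta>0$ and $\gamma>0$ are the inverse temperature and the stepsize of the zeroth-order Langevin algorithm $x_{k+1}=x_k-\gamma g^{\mathrm G}_{h,s}(x_k)+\sqrt{2\gamma\beta^{-1}}z_k$, $z_k\sim\mathcal N(0,I_d)$, in which the estimator is used; they do not enter the estimator. *)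

(* Defs.v *)
From mathcomp Require Import all_boot all_order all_algebra.
From mathcomp Require Import all_classical all_reals all_analysis.
Set Implicit Arguments.
Unset Strict Implicit.
Unset Printing Implicit Defensive.
Import Order.TTheory GRing.Theory Num.Theory.
Import numFieldNormedType.Exports.
Local Open Scope classical_set_scope.
Local Open Scope ring_scope.

(* R^d is 'rV[R]_d. Its library norm `|x| is the sup norm, which induces the
   right topology (hence the right continuity, differentiability and Borel
   sets), but the norm of the statement is the Euclidean one. *)
Definition dotp (R : realType) (d : nat) (x y : 'rV[R]_d) : R :=
  \sum_(j < d) x 0 j * y 0 j.

Definition enorm (R : realType) (d : nat) (x : 'rV[R]_d) : R :=
  Num.sqrt (dotp x x).

Definition grad (R : realType) (d : nat) (F : 'rV[R]_d -> R)
    (x : 'rV[R]_d) : 'rV[R]_d :=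
  \row_(j < d) 'D_(delta_mx 0 j) F x.

Definition smooth (R : realType) (d : nat) (M : R) (F : 'rV[R]_d -> R) : Prop :=
  [/\ forall x, differentiable F x,
      continuous (grad F) &
      forall x y, enorm (grad F x - grad F y) <= M * enorm (x - y)].

Definition dissipative (R : realType) (d : nat) (m b : R)
    (F : 'rV[R]_d -> R) : Prop :=
  forall x, m * enorm x ^+ 2 - b <= dotp x (grad F x).

(* Mutual independence of a finite family of classes of events. *)
Definition independent_classes (R : realType) (disp : measure_display)
    (Omega : measurableType disp) (P : probability Omega R) (I : finType)
    (C : I -> set_system Omega) : Prop :=
  forall (J : {set I}) (A : I -> set Omega),
    (forall i, i \in J -> C i (A i)) ->
    P (\bigcap_(i in [set` J]) A i) = (\prod_(i in J) P (A i))%E.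

(* N(0, I_d), the d-fold product of N(0, 1): the coordinates are independent
   standard normal variables. The laws are compared on measurable sets only,
   because a measure is unspecified elsewhere. *)
Definition std_gaussian (R : realType) (disp : measure_display)
    (Omega : measurableType disp) (P : probability Omega R) (d : nat)
    (u : Omega -> 'rV[R]_d) : Prop :=
  let coord (j : 'I_d) : Omega -> R := fun w => u w 0 j in
  [/\ forall j, measurable_fun setT (coord j),
      forall j (B : set R), measurable B ->
        P (coord j @^-1` B) = normal_prob 0 1 B &
      independent_classes P
        (fun j => preimage_set_system setT (coord j) measurable)].

(* <<s open >> is the Borel sigma-algebra of R^d. *)
Definition independent_vectors (R : realType) (disp : measure_display)
    (Omega : measurableType disp) (P : probability Omega R) (d : nat)
    (I : finType) (u : I -> Omega -> 'rV[R]_d) : Prop :=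
  independent_classes P
    (fun i => preimage_set_system setT (u i) <<s (@open 'rV[R]_d) >>).

Definition zo_estimator (R : realType) (Omega : Type) (d s : nat)
    (F : 'rV[R]_d -> R) (h : R) (u : 'I_s -> Omega -> 'rV[R]_d)
    (x : 'rV[R]_d) (w : Omega) : 'rV[R]_d :=
  s%:R^-1 *: \sum_(i < s) ((F (x + h *: u i w) - F x) / h) *: u i w.

(* E ||g(x) - grad F(x)||^2, valued in \bar R as it may a priori be infinite. *)
Definition grad_error (R : realType) (disp : measure_display)
    (Omega : measurableType disp) (P : probability Omega R) (d : nat)
    (F : 'rV[R]_d -> R) (g : 'rV[R]_d -> Omega -> 'rV[R]_d)
    (x : 'rV[R]_d) : \bar R :=
  'E_P[fun w => enorm (g x w - grad F x) ^+ 2].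

Definition controlled_growth (R : realType) (disp : measure_display)
    (Omega : measurableType disp) (P : probability Omega R) (d : nat)
    (F : 'rV[R]_d -> R) (g : 'rV[R]_d -> Omega -> 'rV[R]_d)
    (delta Pc Qc : R) : Prop :=
  [/\ 0 < delta, 0 <= Pc, 0 <= Qc &
      forall x, (grad_error P F g x <= (delta * (Pc * enorm x ^+ 2 + Qc))%:E)%E].

Definition deltaG (R : realType) (d s : nat) (h : R) : R :=
  d%:R * (d%:R + 2) / s%:R + d%:R * (d%:R + 2) * (d%:R + 4) * h ^+ 2.

(* Main.v *)
From HB Require Import structures.
Require Import Defs.
From mathcomp Require Import all_boot all_order all_algebra.
From mathcomp Require Import all_classical all_reals all_analysis.
From mathcomp Require Import measurable_realfun ring lra.
Set Implicit Arguments.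
Unset Strict Implicit.
Unset Printing Implicit Defensive.
Import Order.TTheory GRing.Theory Num.Theory.
Import numFieldNormedType.Exports.
Local Open Scope classical_set_scope.
Local Open Scope ring_scope.

(* Write G = grad F x. Each term of the estimator splits as
   (<G, u_i> + r_i) u_i, where by the mean value theorem |r_i| <= M h |u_i|^2.
   The vectors <G, u_i> u_i - G are centered, because E[u_i u_i^T] = I, and
   independent, so the second moment of their average is 1/s times that of one
   of them, hence at most C |G|^2 d^2 / s. The remainder contributes at most
   C M^2 h^2 E|u_i|^6 <= C' M^2 h^2 d^3. Power means reduce E|u_i|^4 and
   E|u_i|^6 to moments of N(0, 1), whose finiteness is all that matters. Finally
   |G| <= M |x| + |grad F 0|, and dissipativity tested at the unit vector
   opposite to grad F 0 gives |grad F 0| <= M + b. *)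

(** * The standard normal law: density and moments up to order six *)

(** The Radon-Nikodym derivative of [normal_prob m s] and [normal_pdf m s] have the same integral
    over every measurable set, so they agree almost everywhere and one may replace the other after
    the change of variables. *)
Lemma ge0_integral_normal_prob (R : realType) (m s : R)
    (f : R -> \bar R) :
  measurable_fun setT f -> (forall x, (0 <= f x)%E) ->
  (\int[normal_prob m s]_x f x =
   \int[lebesgue_measure]_x (f x * (normal_pdf m s x)%:E))%E.
Proof.
move=> mf f0; have dom := normal_prob_dominates m s.
have mpdf : measurable_fun setT (fun x : R => (normal_pdf m s x)%:E).
  by apply/measurable_EFinP; exact: measurable_normal_pdf.
rewrite -(Radon_Nikodym_SigmaFinite.change_of_variables dom)//.
apply: ae_eq_integral => //.
- apply: emeasurable_funM => //.
  exact: measurable_int (Radon_Nikodym_SigmaFinite.f_integrable dom).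
- exact: emeasurable_funM.
- apply: ae_eqe_mul2l; apply: integral_ae_eq => //.
    exact: Radon_Nikodym_SigmaFinite.f_integrable.
  by move=> E _ mE; rewrite -Radon_Nikodym_SigmaFinite.f_integral.
Qed.


(** For [y = x^2 / 12], cube [y <= 1 + y <= e^y]. The exponent [x^2 / 4] is half of the Gaussian
    one, so the product with the density still decays like a Gaussian. *)
Lemma X6_le_expR (R : realType) (x : R) :
  x ^+ 6 <= 12 ^+ 3 * expR (x ^+ 2 / 4).
Proof.
set y := x ^+ 2 / 12.
have y0 : 0 <= y by rewrite divr_ge0// sqr_ge0.
have -> : x ^+ 6 = 12 ^+ 3 * y ^+ 3.
  by rewrite -exprMn mulrC divfK// -exprM.
have -> : x ^+ 2 / 4 = 3%:R * y by rewrite /y; lra.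
rewrite ler_pM2l ?exprn_gt0// expRM_natl.
apply: lerXn2r; rewrite ?nnegrE ?expR_ge0//.
by apply: le_trans (expR_ge1Dx y); rewrite lerDr.
Qed.

Lemma normal_pdf01E (R : realType) (x : R) :
  normal_pdf 0 1 x = normal_peak 1 * expR (- (x ^+ 2 / 2)).
Proof.
by rewrite normal_pdfE ?oner_eq0// /normal_fun subr0 expr1n mulNr.
Qed.

(** Since [x^6 e^(-x^2/2) <= 12^3 e^(-x^2/4)], the integrand is dominated by a multiple of the
    normal density of variance 2, whose integral is 1. *)
Lemma normal_X6_lty (R : realType) :
  (\int[@normal_prob R 0 1]_x (x ^+ 6)%:E < +oo)%E.
Proof.
have s0 : Num.sqrt 2 != 0 :> R by rewrite gt_eqF// sqrtr_gt0.
have p0 : 0 < normal_peak (Num.sqrt 2 : R) by exact: normal_peak_gt0.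
(* The ratio of the two peaks converts one normalisation into the other. *)
pose C : R := 12 ^+ 3 * normal_peak 1 / normal_peak (Num.sqrt 2).
have C0 : 0 <= C.
  by rewrite /C divr_ge0 ?mulr_ge0 ?exprn_ge0 ?normal_peak_ge0.
have mX6 : measurable_fun setT (fun x : R => (x ^+ 6)%:E).
  by apply/measurable_EFinP; exact: measurable_funX.
have X60 (x : R) : 0 <= x ^+ 6 by rewrite exprn_even_ge0.
have mpdf m s : measurable_fun setT (fun x : R => (normal_pdf m s x)%:E).
  by apply/measurable_EFinP; exact: measurable_normal_pdf.
rewrite ge0_integral_normal_prob//=.
apply: (@le_lt_trans _ _
  (\int[@lebesgue_measure R]_x (C%:E * (normal_pdf 0 (Num.sqrt 2) x)%:E))%E).
  apply: ge0_le_integral => //=.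
  - by move=> x _; rewrite mule_ge0 ?lee_fin ?X60 ?normal_pdf_ge0.
  - exact: (emeasurable_funM mX6 (mpdf 0 1)).
  - exact: (emeasurable_funM (measurable_cst _) (mpdf 0 _)).
  - move=> x _; rewrite -!EFinM lee_fin normal_pdf01E.
    rewrite normal_pdfE// /normal_fun subr0 /C [leRHS]mulrA divfK ?gt_eqF//.
    rewrite mulrCA [leRHS]mulrAC [leRHS]mulrC ler_wpM2l ?normal_peak_ge0//.
    rewrite sqr_sqrtr// (_ : 2 *+ 2 = 4 :> R); last by rewrite -mulrnA.
    have -> : - x ^+ 2 / 4 = x ^+ 2 / 4 + - (x ^+ 2 / 2) :> R by lra.
    by rewrite expRD mulrA ler_wpM2r ?expR_ge0// X6_le_expR.
by rewrite integralZl//= ?integral_normal_pdf ?mule1 ?ltry//;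
  exact: integrable_normal_pdf.
Qed.

Lemma is_derive_gauss (R : realType) (x : R) :
  is_derive x 1 (fun y : R => - (y * expR (- (y ^+ 2 / 2))))
    ((x ^+ 2 - 1) * expR (- (x ^+ 2 / 2))).
Proof.
have de : is_derive x 1 (fun y : R => expR (- (y ^+ 2 / 2)))
    (expR (- (x ^+ 2 / 2)) * - x).
  have d2 : is_derive x 1 (fun y : R => - (y ^+ 2 / 2)) (- x).
    by apply: is_derive_eq; rewrite /GRing.scale/=; lra.
  exact: (is_derive1_comp (is_derive_expR _) d2).
apply: is_derive_eq.
rewrite /GRing.scale/=; lra.
Qed.

Lemma cvg_gauss (R : realType) :
  - (x * expR (- (x ^+ 2 / 2))) @[x --> +oo%R] --> (0 : R).
Proof.
rewrite -oppr0; apply: cvgN.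
apply: (@squeeze_cvgr _ _ _ _ (fun=> 0) (fun x : R => expR (- x))).
- near=> x.
  (* From 4 on, [x - x^2/2 <= - x], which gives the majorant [e^(-x)]. *)
  have x4 : 4 <= x by near: x; exact: nbhs_pinfty_ge.
  have x0 : 0 <= x by exact: le_trans x4.
  rewrite mulr_ge0 ?expR_ge0//=.
  apply: (@le_trans _ _ (expR x * expR (- (x ^+ 2 / 2)))).
    rewrite ler_wpM2r ?expR_ge0//.
    by apply: le_trans (expR_ge1Dx x); rewrite lerDr.
  rewrite -expRD ler_expR; nra.
- exact: cvg_cst.
- exact: cvgr_expR.
Unshelve. all: by end_near. Qed.

(* [-x e^(-x^2/2)] is an antiderivative of [(x^2 - 1) e^(-x^2/2)], whose sign
   changes at 1: the improper fundamental theorem needs a constant sign. *)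
Lemma integral_gauss_X2 (R : realType) :
  (\int[@lebesgue_measure R]_(x in `[0%R, +oo[)
      (x ^+ 2 * expR (- (x ^+ 2 / 2)))%:E =
   \int[@lebesgue_measure R]_(x in `[0%R, +oo[) (expR (- (x ^+ 2 / 2)))%:E)%E.
Proof.
pose phi (x : R) := expR (- (x ^+ 2 / 2)).
pose Phi (x : R) := - (x * phi x).
have phi0 (x : R) : 0 <= phi x by exact: expR_ge0.
have dPhi (x : R) : is_derive x 1 Phi ((x ^+ 2 - 1) * phi x).
  exact: is_derive_gauss.
have cphi : continuous phi.
  move=> x; apply: (cvg_comp _ expR); last exact: continuous_expR.
  apply: (@cvgN _ R^o); apply: cvgM; last exact: cvg_cst.
  exact: exprn_continuous.
have cX2 : continuous (fun x : R => x ^+ 2) by exact: exprn_continuous.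
have cPhi : continuous Phi.
  by move=> x; apply: cvgN; apply: cvgM; [exact: cvg_id|exact: cphi].
have cg : continuous (fun x : R => (x ^+ 2 - 1) * phi x).
  move=> x; apply: cvgM; last exact: cphi.
  by apply: cvgB; [exact: cX2|exact: cvg_cst].
have mphi : measurable_fun setT phi by exact: continuous_measurable_fun.
have mX2 : measurable_fun setT (fun x : R => x ^+ 2).
  exact: continuous_measurable_fun.
have mX2phi : measurable_fun setT (fun x : R => x ^+ 2 * phi x).
  exact: measurable_funM.
have tail : (\int[lebesgue_measure]_(x in `[1%R, +oo[)
    ((x ^+ 2 - 1) * phi x)%:E = (phi 1)%:E)%E.
  rewrite (@ge0_continuous_FTC2y _ _ Phi 1 0).
  - by rewrite /Phi mul1r -EFinB sub0r opprK.
  - move=> x x1; rewrite mulr_ge0// subr_ge0.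
    by rewrite expr_ge1// (le_trans _ x1).
  - exact: continuous_subspaceT.
  - exact: cvg_gauss.
  - by move=> x _; exact: ex_derive.
  - by apply: cvg_at_right_filter; exact: cPhi.
  - by move=> x _; rewrite derive1E; exact: derive_val.
have head : (\int[lebesgue_measure]_(x in `[0%R, 1%R])
    ((1 - x ^+ 2) * phi x)%:E = (phi 1)%:E)%E.
  rewrite (@continuous_FTC2 _ _ (fun x : R => - Phi x)).
  - by rewrite /Phi !opprK mul1r mul0r sube0.
  - exact: ltr01.
  - apply: continuous_subspaceT => x; apply: cvgM; last exact: cphi.
    by apply: cvgB; [exact: cvg_cst|exact: cX2].
  - split.
    + by move=> x _; exact: ex_derive.
    + by apply: cvg_at_right_filter; apply: cvgN; exact: cPhi.
    + by apply: cvg_at_left_filter; apply: cvgN; exact: cPhi.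
  - move=> x _; rewrite derive1E derive_val; lra.
(* The common endpoint 1 is a null set; removing it makes the two intervals disjoint. *)
have split01 (f : R -> R) : measurable_fun setT f -> (forall x, 0 <= f x) ->
  (\int[lebesgue_measure]_(x in `[0%R, +oo[) (f x)%:E =
   \int[lebesgue_measure]_(x in `[0%R, 1%R]) (f x)%:E +
   \int[lebesgue_measure]_(x in `[1%R, +oo[) (f x)%:E)%E.
  move=> mf f0; rewrite -integral_itv_bndo_bndc; last first.
    exact/measurable_EFinP/measurable_funTS.
  rewrite -ge0_integral_setU//=.
  - by rewrite -itv_bndbnd_setU ?bnd_simp// ?ler01.
  - exact/measurable_EFinP/measurable_funTS.
  - by move=> x _; rewrite lee_fin.
  - apply/disj_setPS => x [] /=; rewrite !in_itv/= => /andP[_ x1] /andP[+ _].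
    by rewrite leNgt x1.
rewrite !split01//; last first.
  by move=> x; rewrite mulr_ge0// sqr_ge0.
(* The boundary term [phi 1] is moved by adding nonnegative functions only, so no finiteness is
   required. Both sides become the same sum of three terms. *)
have -> : (\int[lebesgue_measure]_(x in `[0%R, 1%R]) (phi x)%:E =
  \int[lebesgue_measure]_(x in `[0%R, 1%R]) (x ^+ 2 * phi x)%:E + (phi 1)%:E)%E.
  rewrite -head -ge0_integralD//=.
  - by apply: eq_integral => x _; rewrite -EFinD; congr EFin; lra.
  - by move=> x _; rewrite lee_fin mulr_ge0// sqr_ge0.
  - exact/measurable_EFinP/measurable_funTS.
  - move=> x; rewrite in_itv/= => /andP[x0 x1].
    by rewrite lee_fin mulr_ge0// subr_ge0 expr_le1.
  - apply/measurable_EFinP/measurable_funTS/measurable_funM => //.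
    exact: measurable_funB.
have -> : (\int[lebesgue_measure]_(x in `[1%R, +oo[) (x ^+ 2 * phi x)%:E =
  (phi 1)%:E + \int[lebesgue_measure]_(x in `[1%R, +oo[) (phi x)%:E)%E.
  rewrite -tail -ge0_integralD//=.
  - by apply: eq_integral => x _; rewrite -EFinD; congr EFin; lra.
  - move=> x; rewrite in_itv/= andbT => x1.
    by rewrite lee_fin mulr_ge0// subr_ge0 expr_ge1// (le_trans _ x1).
  - apply/measurable_EFinP/measurable_funTS/measurable_funM => //.
    exact: measurable_funB.
  - by move=> x _; rewrite lee_fin.
  - exact/measurable_EFinP/measurable_funTS.
by rewrite addeA.
Qed.

(** By evenness the half-line identity extends to the whole line; after multiplication by the peak,
    the second moment equals the total mass of the density. *)
Lemma normal_X2E (R : realType) :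
  (\int[@normal_prob R 0 1]_x (x ^+ 2)%:E = 1)%E.
Proof.
pose phi (x : R) := expR (- (x ^+ 2 / 2)).
have phi0 (x : R) : 0 <= phi x by exact: expR_ge0.
have cphi : continuous phi.
  move=> x; apply: (cvg_comp _ expR); last exact: continuous_expR.
  apply: (@cvgN _ R^o); apply: cvgM; last exact: cvg_cst.
  exact: exprn_continuous.
have mphi : measurable_fun setT phi by exact: continuous_measurable_fun.
have cX2phi : continuous (fun x : R => x ^+ 2 * phi x).
  by move=> x; apply: cvgM; [exact: exprn_continuous|exact: cphi].
have mX2phi : measurable_fun setT (fun x : R => x ^+ 2 * phi x).
  exact: continuous_measurable_fun.
have np0 : 0 <= normal_peak 1 :> R by exact: normal_peak_ge0.
rewrite ge0_integral_normal_prob; last 2 first.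
- exact/measurable_EFinP/measurable_funX.
- by move=> x; rewrite lee_fin sqr_ge0.
have eq_half : (\int[lebesgue_measure]_x (x ^+ 2 * phi x)%:E =
    \int[lebesgue_measure]_x (phi x)%:E)%E.
  have X2phi0 (x : R) : 0 <= x ^+ 2 * phi x by rewrite mulr_ge0// sqr_ge0.
  rewrite (ge0_symfun_integralT X2phi0 cX2phi); last first.
    by move=> x /=; rewrite /phi sqrrN.
  rewrite (ge0_symfun_integralT phi0 cphi); last first.
    by move=> x /=; rewrite /phi sqrrN.
  by rewrite -set_itvcy integral_gauss_X2.
rewrite -(integral_normal_pdf (0 : R) 1).
transitivity ((normal_peak 1)%:E *
    \int[lebesgue_measure]_x (x ^+ 2 * phi x)%:E)%E.
  rewrite -ge0_integralZl//=.
  - apply: eq_integral => x _; rewrite normal_pdf01E -!EFinM.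
    by rewrite -/(phi x) mulrCA.
  - exact/measurable_EFinP.
  - by move=> x _; rewrite lee_fin mulr_ge0// sqr_ge0.
rewrite eq_half -ge0_integralZl//=.
- by apply: eq_integral => x _; rewrite normal_pdf01E EFinM.
- exact/measurable_EFinP.
- by move=> x _; rewrite lee_fin.
Qed.

(** The sixth moment controls the lower ones through [|x|^k <= 1 + x^6], by cases on [|x| <= 1]. *)
Lemma normal_integrable (R : realType) (k : nat) : (k <= 6)%N ->
  (@normal_prob R 0 1).-integrable setT (fun x => (x ^+ k)%:E).
Proof.
move=> k6.
have mX n : measurable_fun setT (fun x : R => (x ^+ n)%:E).
  by apply/measurable_EFinP; exact: measurable_funX.
have iX6 : (@normal_prob R 0 1).-integrable setT (fun x => (x ^+ 6)%:E).
  apply/integrableP; split; first exact: mX.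
  under eq_integral do rewrite gee0_abs ?lee_fin ?exprn_even_ge0//.
  exact: normal_X6_lty.
apply: (@le_integrable _ _ _ (@normal_prob R 0 1) _ _ _
  (fun x => (1 + (x : R) ^+ 6)%:E)) => //.
- exact: mX.
- move=> x _; rewrite /= lee_fin [leRHS]ger0_norm ?addr_ge0 ?exprn_even_ge0//.
  have <- : `|x| ^+ 6 = x ^+ 6 by rewrite -normrX ger0_norm// exprn_even_ge0.
  rewrite normrX; have [x1|/ltW x1] := leP `|x| 1.
    by rewrite (le_trans (exprn_ile1 _ (normr_ge0 _) x1))// lerDl exprn_ge0.
  by rewrite (le_trans (ler_weXn2l x1 k6))// lerDr.
- have i1 : (@normal_prob R 0 1).-integrable setT (cst (1%:E : \bar R)).
    exact: finite_measure_integrable_cst.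
  by have := integrableD measurableT i1 iX6.
Qed.

(* By parity [E|Z| = 2 E Z^+], so that [E Z^- = E Z^+], which is finite. *)
Lemma normal_XE (R : realType) : (\int[@normal_prob R 0 1]_x x%:E = 0)%E.
Proof.
pose nu := @normal_prob R 0 1.
pose p (x : R) := Num.max x 0.
pose n (x : R) := Num.max (- x) 0.
have mp : measurable_fun setT (fun x : R => (p x)%:E).
  by apply/measurable_EFinP; exact: measurable_maxr.
have mn : measurable_fun setT (fun x : R => (n x)%:E).
  by apply/measurable_EFinP; exact: measurable_maxr.
have p0 (x : R) : 0 <= p x by rewrite /p le_max lexx orbT.
have n0 (x : R) : 0 <= n x by rewrite /n le_max lexx orbT.
have normE (x : R) : `|x| = p x + n x.
  rewrite /p /n; have [x0|x0] := leP 0 x.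
    by rewrite ger0_norm// max_r ?oppr_le0// addr0.
  by rewrite ltr0_norm// max_l ?oppr_ge0 ?(ltW x0)// add0r.
have iX : nu.-integrable setT (fun x => (x ^+ 1)%:E).
  exact: normal_integrable.
have ip : nu.-integrable setT (fun x => (p x)%:E).
  apply: (le_integrable measurableT _ _ iX) => //= x _.
  by rewrite lee_fin expr1 (ger0_norm (p0 x)) normE lerDl.
have in_ : nu.-integrable setT (fun x => (n x)%:E).
  apply: (le_integrable measurableT _ _ iX) => //= x _.
  by rewrite lee_fin expr1 (ger0_norm (n0 x)) normE lerDr.
have cpdf : continuous (normal_pdf 0 1 : R -> R).
  by apply: continuous_normal_pdf; exact: oner_neq0.
have absE : (\int[nu]_x (p x)%:E + \int[nu]_x (n x)%:E =
    \int[nu]_x (p x)%:E + \int[nu]_x (p x)%:E)%E.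
  rewrite -ge0_integralD//=; [|by move=> x _; rewrite lee_fin..].
  transitivity (\int[nu]_x (`|x : R|%R)%:E)%E.
    by apply: eq_integral => x _; rewrite -EFinD normE.
  rewrite ge0_integral_normal_prob; last 2 first.
  - by apply/measurable_EFinP; exact: normr_measurable.
  - by move=> x; rewrite lee_fin.
  under eq_integral do rewrite -EFinM.
  rewrite (@ge0_symfun_integralT _
    (fun x : R => `|x| * normal_pdf 0 1 x)); first last.
  - by move=> x /=; rewrite normrN !normal_pdf01E sqrrN.
  - by move=> x; apply: cvgM; [exact: norm_continuous|exact: cpdf].
  - by move=> x; rewrite mulr_ge0// normal_pdf_ge0.
  rewrite mule_natl mule2n; suff -> : (\int[nu]_x (p x)%:E =
    \int[lebesgue_measure]_(x in [set x | (0 <= x)%R])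
      (`|x| * normal_pdf 0 1 x)%:E)%E by [].
  rewrite ge0_integral_normal_prob//.
  rewrite [RHS]integral_mkcond/=; apply: eq_integral => x _.
  rewrite patchE -EFinM; case: ifPn; rewrite ?inE ?notin_setE/= => x0.
    by rewrite /p max_l// ger0_norm.
  by rewrite /p max_r ?mul0r// leNgt; apply/negP => /ltW.
have -> : (\int[nu]_x x%:E = \int[nu]_x (p x)%:E - \int[nu]_x (n x)%:E)%E.
  rewrite -integralB//; apply: eq_integral => x _; rewrite -EFinB; congr EFin.
  rewrite /p /n; have [x0|x0] := leP 0 x.
    by rewrite max_r ?oppr_le0// subr0.
  by rewrite max_l ?oppr_ge0 ?(ltW x0)// sub0r opprK.
have fp := integrable_fin_num measurableT ip.
have fn := integrable_fin_num measurableT in_.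
move: absE; rewrite -(fineK fp) -(fineK fn) -!EFinD => -[] /addrI ->.
by rewrite subrr.
Qed.

(** * Expectation of a product of independent variables *)

(** The law of the pair and the product of the two laws agree on rectangles, hence on all measurable
    sets. Fubini's theorem for the product law then factors the integral. *)
Lemma integralM_indep (R : realType) (disp : measure_display)
    (Omega : measurableType disp) (P : probability Omega R) (X Y : Omega -> R) :
  measurable_fun setT X -> measurable_fun setT Y ->
  (forall A B : set R, measurable A -> measurable B ->
    P (X @^-1` A `&` Y @^-1` B) = (P (X @^-1` A) * P (Y @^-1` B))%E) ->
  P.-integrable setT (EFin \o X) -> P.-integrable setT (EFin \o Y) ->
  P.-integrable setT (fun w => (X w * Y w)%:E) ->
  (\int[P]_w (X w * Y w)%:E = \int[P]_w (X w)%:E * \int[P]_w (Y w)%:E)%E.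
Proof.
move=> mX mY XY iX iY iXY.
have mXY : measurable_fun setT (fun w => (X w, Y w)).
  exact: measurable_fun_pair.
pose RX : {RV P >-> R} := HB.pack X (isMeasurableFun.Build _ _ _ _ X mX).
pose RY : {RV P >-> R} := HB.pack Y (isMeasurableFun.Build _ _ _ _ Y mY).
pose RZ : {RV P >-> (R * R)%type} :=
  HB.pack (fun w => (X w, Y w)) (isMeasurableFun.Build _ _ _ _ _ mXY).
pose prod_law := (distribution P RX \x distribution P RY)%E.
have lawE A : measurable A -> prod_law A = distribution P RZ A.
  by move=> mA; apply: product_measure_unique => // B C mB mC; exact: XY.
pose f (z : R * R) := (z.1 * z.2)%:E.
have mf : measurable_fun setT f.
  by apply/measurable_EFinP; exact: measurable_funM.
have iZ : (distribution P RZ).-integrable setT f.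
  by apply: integrable_pushforward => //; rewrite preimage_setT.
have iprod : prod_law.-integrable setT f.
  apply/integrableP; split=> //; move/integrableP : iZ => [_].
  by rewrite (eq_measure_integral prod_law)// => A mA _; exact/esym/lawE.
have iX' : (distribution P RX).-integrable setT EFin.
  by apply: integrable_pushforward => //; rewrite preimage_setT.
have iY' : (distribution P RY).-integrable setT EFin.
  by apply: integrable_pushforward => //; rewrite preimage_setT.
have -> : (\int[P]_w (X w * Y w)%:E = \int[distribution P RZ]_z f z)%E.
  by rewrite integral_distribution.
rewrite (eq_measure_integral prod_law); last by move=> A mA _; exact/esym/lawE.
rewrite -(integral12_prod_meas1 iprod) /fubini_F/=.
have EX : (\int[distribution P RX]_x x%:E = \int[P]_w (X w)%:E)%E.
  by rewrite integral_distribution.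
have EY : (\int[distribution P RY]_x x%:E = \int[P]_w (Y w)%:E)%E.
  by rewrite integral_distribution.
rewrite -EX -EY.
have fY := integrable_fin_num measurableT iY'.
rewrite -[in RHS](fineK fY) -integralZr//; apply: eq_integral => x _.
by rewrite /f/= fineK//; under eq_integral do rewrite EFinM; rewrite integralZl.
Qed.

(** * The Euclidean inner product and norm *)

Section Euclidean.
Variables (R : realType) (d : nat).
Implicit Types x y z : 'rV[R]_d.

Lemma dotpC x y : dotp x y = dotp y x.
Proof. by apply: eq_bigr => j _; rewrite mulrC. Qed.

Lemma dotpDl x y z : dotp (x + y) z = dotp x z + dotp y z.
Proof. by rewrite -big_split; apply: eq_bigr => j _; rewrite !mxE mulrDl. Qed.

Lemma dotpZl a x y : dotp (a *: x) y = a * dotp x y.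
Proof.
by rewrite /dotp mulr_sumr; apply: eq_bigr => j _; rewrite !mxE mulrA.
Qed.

Lemma dotpNl x y : dotp (- x) y = - dotp x y.
Proof. by rewrite -scaleN1r dotpZl mulN1r. Qed.

Lemma dotpDr x y z : dotp x (y + z) = dotp x y + dotp x z.
Proof. by rewrite !(dotpC x) dotpDl. Qed.

Lemma dotpZr a x y : dotp x (a *: y) = a * dotp x y.
Proof. by rewrite !(dotpC x) dotpZl. Qed.

Lemma dotpNr x y : dotp x (- y) = - dotp x y.
Proof. by rewrite !(dotpC x) dotpNl. Qed.

Lemma dotp_ge0 x : 0 <= dotp x x.
Proof. by apply: sumr_ge0 => j _; rewrite -expr2 sqr_ge0. Qed.

Lemma dotp_eq0 x : (dotp x x == 0) = (x == 0).
Proof.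
apply/eqP/eqP => [x0|->]; last first.
  by rewrite /dotp big1// => j _; rewrite mxE mul0r.
apply/rowP => j; rewrite mxE; apply/eqP; rewrite -sqrf_eq0 expr2.
have /psumr_eq0P -> // : \sum_(j < d) x 0 j * x 0 j = 0 by [].
by move=> k _; rewrite -expr2 sqr_ge0.
Qed.

Lemma enorm_ge0 x : 0 <= enorm x.
Proof. exact: sqrtr_ge0. Qed.

Lemma sqr_enorm x : enorm x ^+ 2 = dotp x x.
Proof. by rewrite sqr_sqrtr// dotp_ge0. Qed.

Lemma enormZ a x : enorm (a *: x) = `|a| * enorm x.
Proof.
by rewrite /enorm dotpZl dotpZr mulrA -expr2 sqrtrM ?sqr_ge0// sqrtr_sqr.
Qed.

(** For [y != 0], the squared norm of [<y,y> x - <x,y> y] is [<y,y>] times the difference of the two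
    sides. *)
Lemma dotp_CauchySchwarz x y : dotp x y ^+ 2 <= dotp x x * dotp y y.
Proof.
have [->|y0] := eqVneq y 0.
  have -> : dotp x 0 = 0 by rewrite -(scale0r 0) dotpZr mul0r.
  by rewrite expr0n mulr_ge0// dotp_ge0.
have yy0 : 0 < dotp y y by rewrite lt_neqAle eq_sym dotp_eq0 y0 dotp_ge0.
have := dotp_ge0 (dotp y y *: x - dotp x y *: y).
rewrite dotpDl !dotpDr !dotpNl !dotpNr !dotpZl !dotpZr (dotpC y x) => h.
rewrite -subr_ge0 -(pmulr_rge0 _ yy0); lra.
Qed.

Lemma dotp_le_enorm x y : dotp x y <= enorm x * enorm y.
Proof.
have [h|/ltW h] := leP 0 (dotp x y); last first.
  by rewrite (le_trans h)// mulr_ge0 ?enorm_ge0.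
rewrite -(@ler_pXn2r _ 2) ?nnegrE ?mulr_ge0 ?enorm_ge0// exprMn !sqr_enorm.
exact: dotp_CauchySchwarz.
Qed.

(** The difference of the two sides is the squared norm of [x - y]. *)
Lemma dotp_sqrD_le x y : dotp (x + y) (x + y) <= 2 * dotp x x + 2 * dotp y y.
Proof.
have := dotp_ge0 (x - y).
rewrite !dotpDl !dotpDr !dotpNl !dotpNr; lra.
Qed.

End Euclidean.

(** * Power mean inequalities for finite sums *)

(** With [A] the sum and [n] the number of terms, the sum of the squares [(n a_i - A)^2] is [n]
    times the difference of the two sides. *)
Lemma sqr_sum_le (R : realType) (I : finType) (a : I -> R) :
  (\sum_i a i) ^+ 2 <= #|I|%:R * \sum_i a i ^+ 2.
Proof.
set A := \sum_i a i; set n := #|I|%:R.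
have [n0|n0] := eqVneq n 0.
  have I0 : #|I| = 0%N by apply/eqP; rewrite -(pnatr_eq0 R) -/n n0.
  have noI (i : I) : false by have := card0_eq I0 i; rewrite inE.
  by rewrite /A big1 ?expr0n/= ?n0 ?mul0r// => i; have := noI i.
have np : 0 < n by rewrite lt_neqAle eq_sym n0 ler0n.
have : 0 <= \sum_i (n * a i - A) ^+ 2 by apply: sumr_ge0 => i _; exact: sqr_ge0.
rewrite (eq_bigr (fun i => n ^+ 2 * a i ^+ 2 - (2 * n * A * a i - A ^+ 2)));
  last by move=> i _; ring.
rewrite !sumrB -!mulr_sumr sumr_const -/A -(mulr_natl _ #|_|) -/n => h.
rewrite -subr_ge0 -(pmulr_rge0 _ np); lra.
Qed.

(** The cube lies above its tangent at [A]: [t^3 - 3 A^2 t + 2 A^3 = (t - A)^2 (t + 2 A)],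
    nonnegative at [t = n a_i]. Summing over [i] leaves [n] times the difference of the two
    sides. *)
Lemma cube_sum_le (R : realType) (I : finType) (a : I -> R) :
  (forall i, 0 <= a i) ->
  (\sum_i a i) ^+ 3 <= #|I|%:R ^+ 2 * \sum_i a i ^+ 3.
Proof.
move=> a0; set A := \sum_i a i; set n := #|I|%:R.
have A0 : 0 <= A by exact: sumr_ge0.
have [n0|n0] := eqVneq n 0.
  have I0 : #|I| = 0%N by apply/eqP; rewrite -(pnatr_eq0 R) -/n n0.
  have noI (i : I) : false by have := card0_eq I0 i; rewrite inE.
  by rewrite /A big1 ?expr0n/= ?n0 ?expr0n ?mul0r// => i; have := noI i.
have np : 0 < n by rewrite lt_neqAle eq_sym n0 ler0n.
have : 0 <= \sum_i (n * a i - A) ^+ 2 * (n * a i + 2 * A).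
  apply: sumr_ge0 => i _.
  by rewrite mulr_ge0 ?sqr_ge0// addr_ge0 ?mulr_ge0 ?ler0n.
rewrite (eq_bigr (fun i =>
    n ^+ 3 * a i ^+ 3 - (3 * n * A ^+ 2 * a i - 2 * A ^+ 3))); last first.
  by move=> i _; ring.
rewrite !sumrB -!mulr_sumr sumr_const -/A -(mulr_natl _ #|_|) -/n => h.
rewrite -subr_ge0 -(pmulr_rge0 _ np); lra.
Qed.

(** * Consequences of smoothness and dissipativity *)

Lemma deriveE_grad (R : realType) (d : nat) (F : 'rV[R]_d -> R)
    (x v : 'rV[R]_d) :
  differentiable F x -> 'D_v F x = dotp (grad F x) v.
Proof.
move=> dF; rewrite deriveE// [in LHS](row_sum_delta v) linear_sum.
by apply: eq_bigr => j _; rewrite linearZ/= mxE deriveE// mulrC.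
Qed.

Lemma is_derive_line (R : realType) (d : nat) (F : 'rV[R]_d -> R)
    (x v : 'rV[R]_d) (t : R) :
  differentiable F (x + t *: v) ->
  is_derive t 1 (fun t => F (x + t *: v)) (dotp (grad F (x + t *: v)) v).
Proof.
move=> dF; rewrite -deriveE_grad//.
have quotE : (fun h : R =>
    h^-1 *: (F (x + (h *: 1 + t) *: v) - F (x + t *: v))) =
    (fun h => h^-1 *: (F (h *: v + (x + t *: v)) - F (x + t *: v))).
  by apply/funext => h; rewrite [h *: 1]mulr1 scalerDl addrCA.
split; first by rewrite /derivable/= quotE; exact: diff_derivable.
by rewrite /derive/= quotE.
Qed.

(** The mean value theorem on the segment turns the remainder into
    [<grad F (x + c v) - grad F x, v>] with [0 < c < 1]. Cauchy-Schwarz and the Lipschitz bound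
    conclude. *)
Lemma smooth_remainder (R : realType) (d : nat) (M : R) (F : 'rV[R]_d -> R)
    (x v : 'rV[R]_d) : smooth M F ->
  (F (x + v) - F x - dotp (grad F x) v) ^+ 2 <= (M * dotp v v) ^+ 2.
Proof.
move=> [dF _ lipF].
have [|c c01 FE] := @MVT _ (fun t => F (x + t *: v))
    (fun t => dotp (grad F (x + t *: v)) v) 0 1 ltr01
    (fun t _ => is_derive_line (dF _)).
  apply: continuous_subspaceT => t.
  apply/differentiable_continuous/derivable1_diffP.
  by case: (is_derive_line (dF (x + t *: v))).
move: FE; rewrite scale1r scale0r addr0 subr0 mulr1 => ->.
rewrite -dotpNl -dotpDl.
move: c01; rewrite in_itv/= => /andP[c0 c1].
apply: le_trans (dotp_CauchySchwarz _ _) _.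
rewrite -!sqr_enorm -exprMn.
(* The Lipschitz bound between [v] and 0 forces this product to dominate a norm. *)
have Mv0 : 0 <= M * enorm v.
  by have := lipF v 0; rewrite subr0; exact/le_trans/enorm_ge0.
have Mvv0 : 0 <= M * enorm v ^+ 2 by rewrite expr2 mulrA mulr_ge0 ?enorm_ge0.
apply: lerXn2r; rewrite ?nnegrE//; first by rewrite mulr_ge0 ?enorm_ge0.
rewrite expr2 mulrA ler_wpM2r ?enorm_ge0//.
apply: le_trans (lipF _ _) _.
by rewrite addrAC subrr add0r enormZ gtr0_norm// mulrCA ler_piMl// ltW.
Qed.

(** At the unit vector [v = - g / |g|], dissipativity reads [m - b <= <v, grad F v - g> - |g|],
    where the inner product is at most [M]. The resulting bound is free of [d] and of [F], which the
    choice of uniform constants requires. *)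
Lemma grad0_le (R : realType) (d : nat) (M m b : R) (F : 'rV[R]_d -> R) :
  0 < m -> 0 < b -> smooth M F -> dissipative m b F ->
  dotp (grad F 0) (grad F 0) <= (M + b) ^+ 2.
Proof.
move=> m0 b0 [_ _ lipF] disF; set g := grad F 0.
have [->|g0] := eqVneq g 0.
  by rewrite (_ : dotp 0 0 = 0) ?sqr_ge0//; apply/eqP; rewrite dotp_eq0.
have ng : 0 < enorm g.
  by rewrite sqrtr_gt0 lt_neqAle eq_sym dotp_eq0 g0 dotp_ge0.
pose v := - (enorm g)^-1 *: g.
have nv : enorm v = 1.
  by rewrite enormZ normrN gtr0_norm ?invr_gt0// mulVf// gt_eqF.
have vg : dotp v g = - enorm g.
  by rewrite dotpZl -sqr_enorm expr2 mulrA mulNr mulVf ?gt_eqF// mulN1r.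
have := disF v; rewrite nv expr1n mulr1.
have -> : dotp v (grad F v) = dotp v (grad F v - g) - enorm g.
  by rewrite dotpDr dotpNr vg opprK addrK.
have := dotp_le_enorm v (grad F v - g); rewrite nv mul1r.
have := lipF v 0; rewrite subr0 nv mulr1 -/g => h1 h2 h3.
by rewrite -sqr_enorm; apply: lerXn2r; rewrite ?nnegrE ?enorm_ge0//; lra.
Qed.

(** The gradient is split as its increment from 0, of norm at most [M |x|], plus its value at 0. *)
Lemma grad_le (R : realType) (d : nat) (M m b : R) (F : 'rV[R]_d -> R)
    (x : 'rV[R]_d) :
  0 < m -> 0 < b -> smooth M F -> dissipative m b F ->
  dotp (grad F x) (grad F x) <=
    2 * M ^+ 2 * enorm x ^+ 2 + 2 * (M + b) ^+ 2.
Proof.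
move=> m0 b0 sF disF; have g0 := grad0_le m0 b0 sF disF.
case: sF => _ _ lipF.
have -> : grad F x = (grad F x - grad F 0) + grad F 0 by rewrite subrK.
apply: le_trans (dotp_sqrD_le _ _) _.
have : dotp (grad F x - grad F 0) (grad F x - grad F 0) <=
    M ^+ 2 * enorm x ^+ 2.
  have := lipF x 0; rewrite subr0 => h.
  rewrite -sqr_enorm -exprMn; apply: lerXn2r; rewrite ?nnegrE ?enorm_ge0//.
  by apply: le_trans h; exact: enorm_ge0.
lra.
Qed.

(** * Pointwise bound on the error of the estimator *)

(** This is [(v v^T - I) G] in row form: the deviation of a rank-one matrix from the identity,
    applied to [G]. *)
Definition rank1_dev (R : realType) (d : nat) (G v : 'rV[R]_d) : 'rV[R]_d :=
  dotp G v *: v - G.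

(** The coordinatewise form reduces the orthogonality of independent vectors to that of real
    variables. *)
Lemma dotp_sumE (R : realType) (d : nat) (I : finType) (V : I -> 'rV[R]_d) :
  dotp (\sum_i V i) (\sum_i V i) = \sum_j (\sum_i V i 0 j) ^+ 2.
Proof. by apply: eq_bigr => j _; rewrite summxE expr2. Qed.

Lemma dotp_sum_le (R : realType) (d : nat) (I : finType) (V : I -> 'rV[R]_d) :
  dotp (\sum_i V i) (\sum_i V i) <= #|I|%:R * \sum_i dotp (V i) (V i).
Proof.
rewrite dotp_sumE exchange_big mulr_sumr/=; apply: ler_sum => j _.
by apply: le_trans (sqr_sum_le _) _; rewrite ler_wpM2l.
Qed.

Lemma dotpX3_le (R : realType) (d : nat) (v : 'rV[R]_d) :
  dotp v v ^+ 3 <= d%:R ^+ 2 * \sum_j v 0 j ^+ 6.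
Proof.
have v2E : dotp v v = \sum_j v 0 j ^+ 2 by [].
have v6E : \sum_j v 0 j ^+ 6 = \sum_j (v 0 j ^+ 2) ^+ 3.
  by apply: eq_bigr => j _; rewrite -exprM.
rewrite v2E v6E (_ : d%:R = #|'I_d|%:R); last by rewrite card_ord.
by apply: cube_sum_le => j; exact: sqr_ge0.
Qed.

(** Splitting the difference and applying Cauchy-Schwarz to [<G, v>] gives [2 |G|^2 (|v|^4 + 1)];
    the power mean then bounds [|v|^4] by fourth powers of coordinates. *)
Lemma dotp_rank1_dev_le (R : realType) (d : nat) (G v : 'rV[R]_d) :
  dotp (rank1_dev G v) (rank1_dev G v) <=
    2 * dotp G G * (d%:R * (\sum_j v 0 j ^+ 4) + 1).
Proof.
have v4 : dotp v v ^+ 2 <= d%:R * \sum_j v 0 j ^+ 4.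
  have v2E : dotp v v = \sum_j v 0 j ^+ 2 by [].
  have v4E : \sum_j v 0 j ^+ 4 = \sum_j (v 0 j ^+ 2) ^+ 2.
    by apply: eq_bigr => j _; rewrite -exprM.
  rewrite v2E v4E (_ : d%:R = #|'I_d|%:R); last by rewrite card_ord.
  exact: sqr_sum_le.
apply: le_trans (dotp_sqrD_le _ _) _.
rewrite dotpZl dotpZr dotpNl dotpNr opprK.
have := ler_wpM2r (dotp_ge0 v) (dotp_CauchySchwarz G v).
have := ler_wpM2l (dotp_ge0 G) v4.
lra.
Qed.

(** The sum of the centered terms stays inside the square, so that its cross terms can cancel in
    expectation. The remainders are small already and are bounded one by one. *)
Lemma zo_error_le (R : realType) (Omega : Type) (d s : nat) (M h : R)
    (F : 'rV[R]_d -> R) (u : 'I_s -> Omega -> 'rV[R]_d) (x : 'rV[R]_d)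
    (w : Omega) :
  (0 < s)%N -> 0 < h -> smooth M F ->
  enorm (zo_estimator F h u x w - grad F x) ^+ 2 <=
    2 / s%:R ^+ 2 * (\sum_j (\sum_i rank1_dev (grad F x) (u i w) 0 j) ^+ 2) +
    2 * M ^+ 2 * h ^+ 2 * d%:R ^+ 2 / s%:R * (\sum_i \sum_j u i w 0 j ^+ 6).
Proof.
move=> s0 h0 sF; set G := grad F x.
have sR : s%:R != 0 :> R by rewrite pnatr_eq0 -lt0n.
have sp : 0 < s%:R :> R by rewrite ltr0n.
pose r i := (F (x + h *: u i w) - F x) / h - dotp G (u i w).
have zoE : zo_estimator F h u x w - G =
    s%:R^-1 *: (\sum_i rank1_dev G (u i w) + \sum_i r i *: u i w).
  rewrite -big_split/= (eq_bigr (fun i =>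
      ((F (x + h *: u i w) - F x) / h) *: u i w - G)); last first.
    by move=> i _; rewrite /rank1_dev /r [LHS]addrC scalerBl addrA subrK.
  rewrite sumrB sumr_const card_ord scalerBr -(scaler_nat _ G) scalerA.
  by rewrite mulVf ?scale1r.
(* As [|r_i| <= M h |u_i|^2], the squared norm is at most [M^2 h^2 |u_i|^6]. *)
have rle i : dotp (r i *: u i w) (r i *: u i w) <=
    M ^+ 2 * h ^+ 2 * d%:R ^+ 2 * \sum_j u i w 0 j ^+ 6.
  have rr : r i ^+ 2 <= (M * h * dotp (u i w) (u i w)) ^+ 2.
    have := smooth_remainder x (h *: u i w) sF.
    rewrite dotpZl !dotpZr -/G.
    have -> : F (x + h *: u i w) - F x - h * dotp G (u i w) = h * r i.
      by rewrite /r mulrBr mulrCA divff ?gt_eqF// mulr1.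
    have -> : M * (h * (h * dotp (u i w) (u i w))) =
        h * (M * h * dotp (u i w) (u i w)) by ring.
    by rewrite !(exprMn _ h) ler_pM2l// exprn_gt0.
  rewrite dotpZl dotpZr mulrA -expr2.
  apply: le_trans (ler_wpM2r (dotp_ge0 _) rr) _.
  have -> : (M * h * dotp (u i w) (u i w)) ^+ 2 * dotp (u i w) (u i w) =
      M ^+ 2 * h ^+ 2 * dotp (u i w) (u i w) ^+ 3 by ring.
  rewrite -[leRHS]mulrA ler_wpM2l ?dotpX3_le//.
  by rewrite mulr_ge0// sqr_ge0.
rewrite sqr_enorm zoE dotpZl dotpZr mulrA.
(* The factor [s] in front of the remainders is the cost of bounding the squared norm of a sum of
   [s] vectors termwise; it turns [1/s^2] into [1/s]. *)
apply: (@le_trans _ _ (s%:R^-1 * s%:R^-1 *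
    (2 * \sum_j (\sum_i rank1_dev G (u i w) 0 j) ^+ 2 +
     2 * (s%:R * \sum_i M ^+ 2 * h ^+ 2 * d%:R ^+ 2 * \sum_j u i w 0 j ^+ 6)))).
  rewrite ler_wpM2l ?mulr_ge0 ?invr_ge0//.
  apply: le_trans (dotp_sqrD_le _ _) _; rewrite dotp_sumE lerD2l ler_wpM2l//.
  apply: le_trans (dotp_sum_le _) _; rewrite card_ord ler_wpM2l//.
  exact: ler_sum.
rewrite -mulr_sumr le_eqVlt; apply/orP; left; apply/eqP.
by field.
Qed.

(** * Independent events and comparison of integrals *)

(** Open half-lines generate the Borel sets of [R], and their preimages are open. Independence of
    vectors thus passes to continuous real functions of them. *)
Lemma continuous_borel_preimage (R : realType) (T : ptopologicalType)
    (phi : T -> R) (B : set R) :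
  continuous phi -> measurable B -> <<s @open T >> (phi @^-1` B).
Proof.
move=> cphi mB.
have mphi : measurable_fun setT (phi : g_sigma_algebraType (@open T) -> R).
  apply: (measurability _ (RGenOInfty.measurableE R)) => _ [_ [x ->] <-].
  apply: measurableI => //; apply: sub_sigma_algebra.
  by move/continuousP: cphi; apply; rewrite set_itvoy; exact: open_gt.
by have := mphi measurableT _ mB; rewrite setTI.
Qed.

Lemma independent_classes2 (R : realType) (disp : measure_display)
    (Omega : measurableType disp) (P : probability Omega R) (I : finType)
    (C : I -> set_system Omega) (i k : I) (A B : set Omega) :
  independent_classes P C -> i != k -> C i A -> C k B ->
  P (A `&` B) = (P A * P B)%E.
Proof.
move=> indC ik CA CB.
have ki : k != i by rewrite eq_sym.
have := indC [set i; k]%SET (fun l => if l == i then A else B).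
have -> : [set` [set i; k]%SET] = i |` [set k].
  apply/seteqP; split => l /=; rewrite !inE.
    by move=> /orP[]/eqP ->; [left|right].
  by move=> [->|->]; rewrite eqxx ?orbT.
rewrite bigcap_setU1 bigcap_set1 eqxx (negbTE ki) => -> .
  by rewrite big_setU1 ?inE//= big_set1 eqxx (negbTE ki).
by move=> l; rewrite !inE => /orP[]/eqP ->; rewrite ?eqxx ?(negbTE ki).
Qed.

(* Unlike [ge0_le_integral], this asks for no measurability, which spares the
   measurability of the estimator. *)
Lemma ge0_le_integral_nomeasurable (R : realType) (disp : measure_display)
    (Omega : measurableType disp) (mu : {measure set Omega -> \bar R})
    (f g : Omega -> \bar R) :
  (forall w, 0 <= f w)%E -> (forall w, f w <= g w)%E ->
  (\int[mu]_w f w <= \int[mu]_w g w)%E.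
Proof.
move=> f0 fg; rewrite !ge0_integralTE//; last first.
  by move=> w; exact: le_trans (f0 w) (fg w).
apply: ereal_sup_le => _ [k kf <-]; exists k => // w.
exact: le_trans (kf w) (fg w).
Qed.

(** * Second moments of real random variables *)

Section RealExpectation.
Variables (R : realType) (disp : measure_display) (Omega : measurableType disp).
Variable P : probability Omega R.
Implicit Types X Y : Omega -> R.

Lemma integrable_Rsum (I : finType) (X : I -> Omega -> R) :
  (forall i, P.-integrable setT (EFin \o X i)) ->
  P.-integrable setT (EFin \o (fun w => \sum_i X i w)).
Proof.
move=> iX; have := integrable_sum measurableT (index_enum I)
  (P := predT) (fun i _ => iX i).
by apply: eq_integrable => // w _; rewrite /= sumEFin.
Qed.

Lemma Rintegral_sum (I : finType) (X : I -> Omega -> R) :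
  (forall i, P.-integrable setT (EFin \o X i)) ->
  \int[P]_w (\sum_i X i w) = \sum_i \int[P]_w X i w.
Proof.
move=> iX; apply: EFin_inj; rewrite -sumEFin.
rewrite fineK; last by apply: integrable_fin_num => //; exact: integrable_Rsum.
under eq_integral do rewrite -sumEFin.
rewrite integral_sum//; apply: eq_bigr => i _.
by rewrite fineK//; exact: (integrable_fin_num measurableT (iX i)).
Qed.

Lemma Rintegral_prob_cst (c : R) : \int[P]_(_ in setT) c = c.
Proof.
rewrite Rintegral_cst// (_ : fine _ = 1) ?mulr1//.
by have /(congr1 fine) := @probability_setT _ _ _ P.
Qed.

(** The product is dominated by [X^2 + Y^2]. *)
Lemma integrable_Rmul X Y :
  measurable_fun setT X -> measurable_fun setT Y ->
  P.-integrable setT (EFin \o (fun w => X w ^+ 2)) ->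
  P.-integrable setT (EFin \o (fun w => Y w ^+ 2)) ->
  P.-integrable setT (EFin \o (fun w => X w * Y w)).
Proof.
move=> mX mY iX iY.
apply: le_integrable (integrableD measurableT iX iY) => //.
  by apply/measurable_EFinP; exact: measurable_funM.
move=> w _ /=; rewrite lee_fin normrM [leRHS]ger0_norm ?addr_ge0 ?sqr_ge0//.
by rewrite -(real_normK (num_real (X w))) -(real_normK (num_real (Y w))); nra.
Qed.

Lemma integrable_Rsqr X : measurable_fun setT X ->
  P.-integrable setT (EFin \o (fun w => X w ^+ 2)) ->
  P.-integrable setT (EFin \o X).
Proof.
move=> mX iX.
have i1 : P.-integrable setT (EFin \o (fun=> (1 : R) ^+ 2)).
  exact: finite_measure_integrable_cst.
have := integrable_Rmul mX (measurable_cst (1 : R)) iX i1.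
by apply: eq_integrable => // w _ /=; rewrite mulr1.
Qed.

Lemma integrable_sqr_sum (I : finType) (Y : I -> Omega -> R) :
  (forall i, measurable_fun setT (Y i)) ->
  (forall i, P.-integrable setT (EFin \o (fun w => Y i w ^+ 2))) ->
  P.-integrable setT (EFin \o (fun w => (\sum_i Y i w) ^+ 2)).
Proof.
move=> mY iY.
have := integrable_Rsum (fun i => integrable_Rsum (fun k =>
  integrable_Rmul (mY i) (mY k) (iY i) (iY k))).
apply: eq_integrable => // w _ /=; rewrite expr2 mulr_suml.
by under eq_bigr do rewrite -mulr_sumr.
Qed.

(** Once the square is expanded, only the diagonal terms survive. *)
Lemma Rintegral_sqr_sum (I : finType) (Y : I -> Omega -> R) :
  (forall i, measurable_fun setT (Y i)) ->
  (forall i, P.-integrable setT (EFin \o (fun w => Y i w ^+ 2))) ->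
  (forall i k, i != k -> \int[P]_w (Y i w * Y k w) = 0) ->
  \int[P]_w ((\sum_i Y i w) ^+ 2) = \sum_i \int[P]_w (Y i w ^+ 2).
Proof.
move=> mY iY orthY.
have iYY i k := integrable_Rmul (mY i) (mY k) (iY i) (iY k).
transitivity (\int[P]_w (\sum_i \sum_k Y i w * Y k w)).
  apply: eq_Rintegral => w _; rewrite expr2 mulr_suml.
  by apply: eq_bigr => i _; rewrite mulr_sumr.
rewrite Rintegral_sum => [|i]; last exact: integrable_Rsum.
apply: eq_bigr => i _; rewrite Rintegral_sum// (bigD1 i)//= big1 ?addr0//.
by move=> k ki; apply: orthY; rewrite eq_sym.
Qed.

(** Square integrability yields the integrability of both factors and of their product. *)
Lemma RintegralM_indep X Y :
  measurable_fun setT X -> measurable_fun setT Y ->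
  (forall A B : set R, measurable A -> measurable B ->
    P (X @^-1` A `&` Y @^-1` B) = (P (X @^-1` A) * P (Y @^-1` B))%E) ->
  P.-integrable setT (EFin \o (fun w => X w ^+ 2)) ->
  P.-integrable setT (EFin \o (fun w => Y w ^+ 2)) ->
  \int[P]_w (X w * Y w) = \int[P]_w X w * \int[P]_w Y w.
Proof.
move=> mX mY XY iX iY.
have iX1 := integrable_Rsqr mX iX; have iY1 := integrable_Rsqr mY iY.
rewrite {1}/Rintegral (integralM_indep mX mY XY iX1 iY1); last first.
  exact: integrable_Rmul.
by rewrite fineM//; exact: (integrable_fin_num measurableT).
Qed.

End RealExpectation.

(** * Moments of Gaussian vectors *)

(** Up to [k = 6] the integral is finite, so [fine] loses nothing. Orders 4 and 6 stay symbolic and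
    enter the final constants. *)
Definition normal_moment (R : realType) (k : nat) : R :=
  fine (\int[@normal_prob R 0 1]_x (x ^+ k)%:E).

Lemma normal_moment_ge0 (R : realType) (k : nat) :
  ~~ odd k -> 0 <= normal_moment R k.
Proof.
move=> ek; apply/fine_ge0/integral_ge0 => x _.
by rewrite lee_fin exprn_even_ge0.
Qed.

Section GaussianVector.
Variables (R : realType) (disp : measure_display) (Omega : measurableType disp).
Variables (P : probability Omega R) (d : nat) (u : Omega -> 'rV[R]_d).
Hypothesis gu : std_gaussian P u.

Lemma std_gaussian_measurable (j : 'I_d) :
  measurable_fun setT (fun w => u w 0 j).
Proof. by case: gu. Qed.

Lemma std_gaussian_integrable (j : 'I_d) (k : nat) : (k <= 6)%N ->
  P.-integrable setT (EFin \o (fun w => u w 0 j ^+ k)).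
Proof.
move=> k6; case: gu => mu_ lawu _.
(* [normal_prob] is a measure on a copy of [R] with another display. *)
have mX : measurable_fun setT
    (fun w => u w 0 j : g_sigma_algebraType R.-ocitv.-measurable) := mu_ j.
pose X : {RV P >-> g_sigma_algebraType R.-ocitv.-measurable} :=
  HB.pack (fun w => u w 0 j) (isMeasurableFun.Build _ _ _ _ _ mX).
have mk : measurable_fun setT (fun x : R => (x ^+ k)%:E).
  by apply/measurable_EFinP; exact: measurable_funX.
have /integrableP[_ klt] := @normal_integrable R k k6.
apply/integrableP; split; first exact: (measurableT_comp mk (mu_ j)).
apply: le_lt_trans klt; rewrite le_eqVlt; apply/orP; left; apply/eqP.
rewrite -(ge0_integral_distribution X (f := fun x => `|((x : R) ^+ k)%:E|%E))//.
  by apply: eq_measure_integral => A mA _; exact: lawu.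
exact: measurableT_comp.
Qed.

Lemma std_gaussian_moment (j : 'I_d) (k : nat) : (k <= 6)%N ->
  \int[P]_w (u w 0 j ^+ k) = normal_moment R k.
Proof.
move=> k6; case: gu => mu_ lawu _.
have mX : measurable_fun setT
    (fun w => u w 0 j : g_sigma_algebraType R.-ocitv.-measurable) := mu_ j.
pose X : {RV P >-> g_sigma_algebraType R.-ocitv.-measurable} :=
  HB.pack (fun w => u w 0 j) (isMeasurableFun.Build _ _ _ _ _ mX).
have mk : measurable_fun setT (fun x : R => (x ^+ k)%:E).
  by apply/measurable_EFinP; exact: measurable_funX.
congr fine.
rewrite -(@integral_distribution _ _ _ _ _ _ X (fun x => ((x : R) ^+ k)%:E))//.
  by apply: eq_measure_integral => A mA _; exact: lawu.
exact: std_gaussian_integrable.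
Qed.

(** The diagonal is the second moment of [N(0, 1)]; off the diagonal, independence of the
    coordinates gives a product of zero means. *)
Lemma std_gaussian_cov (a b : 'I_d) :
  \int[P]_w (u w 0 a * u w 0 b) = (a == b)%:R.
Proof.
have [->|ab] := eqVneq a b.
  have -> : (1 = normal_moment R 2) by rewrite /normal_moment normal_X2E.
  by rewrite -(std_gaussian_moment b (k := 2)).
have mean0 j : \int[P]_w (u w 0 j) = 0.
  have -> : 0 = normal_moment R 1 by rewrite /normal_moment normal_XE.
  exact: (std_gaussian_moment j (k := 1)).
rewrite RintegralM_indep ?mean0 ?mulr0//; try exact: std_gaussian_measurable.
- move=> A B mA mB; case: gu => _ _ indu.
  apply: (independent_classes2 indu ab); [exists A|exists B] => //;
    by rewrite setTI.
- exact: (std_gaussian_integrable a (k := 2)).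
- exact: (std_gaussian_integrable b (k := 2)).
Qed.

Variable G : 'rV[R]_d.

Lemma rank1_devE (v : 'rV[R]_d) (a : 'I_d) :
  rank1_dev G v 0 a = (\sum_b G 0 b * (v 0 b * v 0 a)) - G 0 a.
Proof.
by rewrite !mxE mulr_suml; congr (_ - _); apply: eq_bigr => b _; rewrite mulrA.
Qed.

Let integrable_coordM (a b : 'I_d) :
  P.-integrable setT (EFin \o (fun w => u w 0 a * u w 0 b)).
Proof.
apply: integrable_Rmul; try exact: std_gaussian_measurable;
  exact: std_gaussian_integrable.
Qed.

Lemma rank1_dev_measurable (a : 'I_d) :
  measurable_fun setT (fun w => rank1_dev G (u w) 0 a).
Proof.
under eq_fun do rewrite rank1_devE.
apply: measurable_funB => //; apply: measurable_sum => b.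
apply: measurable_funM => //; apply: measurable_funM;
  exact: std_gaussian_measurable.
Qed.

(** By linearity the identity covariance sends [G] to itself, and [G] is subtracted. *)
Lemma Rintegral_rank1_dev (a : 'I_d) : \int[P]_w rank1_dev G (u w) 0 a = 0.
Proof.
have iGuu b :
    P.-integrable setT (EFin \o (fun w => G 0 b * (u w 0 b * u w 0 a))).
  exact: (integrableZl measurableT (G 0 b) (integrable_coordM b a)).
under eq_Rintegral do rewrite rank1_devE.
rewrite RintegralB//; last first.
- exact: finite_measure_integrable_cst.
- exact: integrable_Rsum.
rewrite Rintegral_prob_cst Rintegral_sum//.
apply/eqP; rewrite subr_eq0; apply/eqP.
transitivity (\sum_b G 0 b * (b == a)%:R).
  apply: eq_bigr => b _; rewrite RintegralZl// ?std_gaussian_cov//.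
rewrite (bigD1 a)//= eqxx mulr1 big1 ?addr0// => b /negbTE ->.
by rewrite mulr0.
Qed.

Let integrable_dev_bound : P.-integrable setT
  (EFin \o (fun w => 2 * dotp G G * (d%:R * (\sum_j u w 0 j ^+ 4) + 1))).
Proof.
have i4 := integrable_Rsum (fun j => @std_gaussian_integrable j 4 isT).
have i1 : P.-integrable setT (EFin \o (fun=> 1 : R)).
  exact: finite_measure_integrable_cst.
apply: (integrableZl measurableT (2 * dotp G G)
  (integrableD measurableT (integrableZl measurableT d%:R i4) i1)).
Qed.

(** One squared coordinate is at most the squared norm, which has an integrable majorant. *)
Lemma rank1_dev_integrable_sqr (a : 'I_d) :
  P.-integrable setT (EFin \o (fun w => rank1_dev G (u w) 0 a ^+ 2)).
Proof.
apply: le_integrable integrable_dev_bound => //.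
  by apply/measurable_EFinP/measurable_funX; exact: rank1_dev_measurable.
move=> w _; rewrite /= lee_fin ger0_norm ?sqr_ge0//.
apply: le_trans (ler_norm _); apply: le_trans (dotp_rank1_dev_le _ _).
rewrite /dotp (bigD1 a)//= expr2 lerDl; apply: sumr_ge0 => j _.
by rewrite -expr2 sqr_ge0.
Qed.

Lemma Rintegral_rank1_dev_sqr_le :
  \sum_a \int[P]_w (rank1_dev G (u w) 0 a ^+ 2) <=
    2 * dotp G G * (d%:R ^+ 2 * normal_moment R 4 + 1).
Proof.
rewrite -Rintegral_sum; last exact: rank1_dev_integrable_sqr.
have i4 := integrable_Rsum (fun j => @std_gaussian_integrable j 4 isT).
have i1 : P.-integrable setT (EFin \o (fun=> 1 : R)).
  exact: finite_measure_integrable_cst.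
apply: (@le_trans _ _ (\int[P]_w
    (2 * dotp G G * (d%:R * (\sum_j u w 0 j ^+ 4) + 1)))).
  apply: le_Rintegral => //.
    by apply: integrable_Rsum; exact: rank1_dev_integrable_sqr.
  by move=> w _; apply: le_trans (dotp_rank1_dev_le _ _).
have id4 := integrableZl measurableT d%:R i4.
rewrite RintegralZl//; last exact: (integrableD measurableT id4 i1).
rewrite RintegralD// RintegralZl// Rintegral_sum; last first.
  by move=> j; exact: std_gaussian_integrable.
under eq_bigr do rewrite std_gaussian_moment//.
(* The [d] equal fourth moments supply the second factor [d]. *)
rewrite sumr_const card_ord Rintegral_prob_cst.
by rewrite -[normal_moment R 4 *+ d]mulr_natl [d%:R * (_ * _)]mulrA -expr2.
Qed.

End GaussianVector.

(** * Expected squared error of the estimator *)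

Lemma continuous_rank1_dev (R : realType) (d : nat) (G : 'rV[R]_d) (a : 'I_d) :
  continuous (fun v : 'rV[R]_d => rank1_dev G v 0 a).
Proof.
have -> : (fun v => rank1_dev G v 0 a) =
    (fun v : 'rV[R]_d => (\sum_b G 0 b * (v 0 b * v 0 a)) - G 0 a).
  by apply/funext => v; rewrite rank1_devE.
have cM b (v : 'rV[R]_d) :
    {for v, continuous (fun x : 'rV[R]_d => G 0 b * (x 0 b * x 0 a))}.
  apply: continuousM; first exact: cst_continuous.
  by apply: continuousM; exact: coord_continuous.
move=> v; apply: continuousB; last exact: cst_continuous.
by apply: cvg_big => [||b _];
  [exact: add_continuous|exact: (nbhs_filter v)|exact: cM].
Qed.

Section ExpectedError.
Variables (R : realType) (disp : measure_display) (Omega : measurableType disp).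
Variables (P : probability Omega R) (d s : nat).
Variable u : 'I_s -> Omega -> 'rV[R]_d.
Hypothesis gu : forall i, std_gaussian P (u i).
Hypothesis indu : independent_vectors P u.

(** For distinct indices the deviations are independent and centered, hence orthogonal. This is the
    source of the [1/s] rate. *)
Lemma Rintegral_sum_rank1_dev (G : 'rV[R]_d) (a : 'I_d) :
  \int[P]_w ((\sum_i rank1_dev G (u i w) 0 a) ^+ 2) =
  \sum_i \int[P]_w (rank1_dev G (u i w) 0 a ^+ 2).
Proof.
have mY i := rank1_dev_measurable (gu i) G a.
have iY i := rank1_dev_integrable_sqr (gu i) G a.
apply: (Rintegral_sqr_sum mY iY) => i k ik.
rewrite RintegralM_indep ?Rintegral_rank1_dev ?mulr0// => A B mA mB.
have cdev := @continuous_rank1_dev R d G a.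
apply: (independent_classes2 indu ik).
  exists ((fun v => rank1_dev G v 0 a) @^-1` A); last by rewrite setTI.
  exact: continuous_borel_preimage.
exists ((fun v => rank1_dev G v 0 a) @^-1` B); last by rewrite setTI.
exact: continuous_borel_preimage.
Qed.

Lemma grad_error_zo_le (M h : R) (F : 'rV[R]_d -> R) (x : 'rV[R]_d) :
  (0 < s)%N -> 0 < h -> smooth M F ->
  (grad_error P F (zo_estimator F h u) x <=
    (4 / s%:R * dotp (grad F x) (grad F x) *
       (d%:R ^+ 2 * normal_moment R 4 + 1) +
     2 * M ^+ 2 * h ^+ 2 * d%:R ^+ 3 * normal_moment R 6)%:E)%E.
Proof.
move=> s0 h0 sF; set G := grad F x.
have sR : s%:R != 0 :> R by rewrite pnatr_eq0 -lt0n.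
pose A w := \sum_j (\sum_i rank1_dev G (u i w) 0 j) ^+ 2.
pose B w := \sum_i \sum_j u i w 0 j ^+ 6.
pose alpha : R := 2 / s%:R ^+ 2.
pose kappa : R := 2 * M ^+ 2 * h ^+ 2 * d%:R ^+ 2 / s%:R.
have mY j i := rank1_dev_measurable (gu i) G j.
have iY j i := rank1_dev_integrable_sqr (gu i) G j.
have iY2 j := integrable_sqr_sum (mY j) (iY j).
have iA : P.-integrable setT (EFin \o A) by exact: integrable_Rsum.
have i6 i j := std_gaussian_integrable (gu i) j (k := 6) isT.
have i6s i := integrable_Rsum (i6 i).
have iB : P.-integrable setT (EFin \o B) by exact: integrable_Rsum.
have iaA : P.-integrable setT (EFin \o (fun w => alpha * A w)).
  exact: (integrableZl measurableT alpha iA).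
have ikB : P.-integrable setT (EFin \o (fun w => kappa * B w)).
  exact: (integrableZl measurableT kappa iB).
have iAB : P.-integrable setT (EFin \o (fun w => alpha * A w + kappa * B w)).
  exact: (integrableD measurableT iaA ikB).
rewrite /grad_error unlock.
(* The pointwise bound is integrated: [A] collects the centered terms and [B] the sixth powers from
   the remainders. *)
apply: (@le_trans _ _ (\int[P]_w (alpha * A w + kappa * B w)%:E)%E).
  apply: ge0_le_integral_nomeasurable => w; first by rewrite lee_fin sqr_ge0.
  by rewrite lee_fin; exact: zo_error_le.
rewrite -(fineK (integrable_fin_num measurableT iAB)) lee_fin.
rewrite -/(Rintegral P setT (fun w => alpha * A w + kappa * B w)).
rewrite RintegralD// !RintegralZl//.
have -> : \int[P]_w B w = s%:R * (d%:R * normal_moment R 6).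
  rewrite Rintegral_sum//.
  under eq_bigr do rewrite Rintegral_sum//.
  under eq_bigr do under eq_bigr do rewrite (std_gaussian_moment (gu _))//.
  by rewrite !sumr_const !card_ord !mulr_natl.
have EA : \int[P]_w A w <=
    s%:R * (2 * dotp G G * (d%:R ^+ 2 * normal_moment R 4 + 1)).
  rewrite Rintegral_sum//.
  under eq_bigr do rewrite Rintegral_sum_rank1_dev.
  rewrite exchange_big/= mulr_natl -[in leRHS](card_ord s) -sumr_const.
  by apply: ler_sum => i _; exact: Rintegral_rank1_dev_sqr_le.
have alpha0 : 0 <= alpha by rewrite divr_ge0 ?exprn_ge0.
apply: le_trans (lerD (ler_wpM2l alpha0 EA) (lexx _)) _.
rewrite le_eqVlt; apply/orP; left; apply/eqP; rewrite /alpha /kappa.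
by field.
Qed.

End ExpectedError.

(** * Comparison with [deltaG] and choice of the constants *)

Lemma deltaG_gt0 (R : realType) (d s : nat) (h : R) :
  (0 < d)%N -> (0 < s)%N -> 0 < h -> 0 < deltaG d s h.
Proof.
move=> d0 s0 h0; have dR : 0 < d%:R :> R by rewrite ltr0n.
have sR : 0 < s%:R :> R by rewrite ltr0n.
by rewrite /deltaG addr_gt0// ?divr_gt0 ?mulr_gt0 ?addr_gt0 ?exprn_gt0.
Qed.

(** The two terms are matched with the two summands of [deltaG], using
    [d^2 c4 + 1 <= d (d + 2) (c4 + 1)] for [d >= 1] and [d^3 <= d (d + 2) (d + 4)]. *)
Lemma growth_constants_le (R : realType) (d s : nat) (h M c4 c6 G2 g : R) :
  (0 < d)%N -> 0 <= c4 -> 0 <= c6 -> 0 <= G2 -> G2 <= g ->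
  4 / s%:R * G2 * (d%:R ^+ 2 * c4 + 1) +
    2 * M ^+ 2 * h ^+ 2 * d%:R ^+ 3 * c6 <=
  deltaG d s h * (4 * (c4 + 1) * g + 2 * M ^+ 2 * c6).
Proof.
move=> d0 c40 c60 G20 G2g.
have dR : 1 <= d%:R :> R by rewrite ler1n.
have dR0 : 0 <= d%:R :> R by rewrite ler0n.
have sR : 0 <= s%:R^-1 :> R by rewrite invr_ge0.
have g0 : 0 <= g by exact: le_trans G2g.
set D : R := d%:R in dR dR0 *; set t := s%:R^-1 in sR *.
have M0 := sqr_ge0 M; have h20 := sqr_ge0 h.
pose a := D * (D + 2) * t; pose e := D * (D + 2) * (D + 4) * h ^+ 2.
have a0 : 0 <= a by rewrite !mulr_ge0 ?addr_ge0.
have e0 : 0 <= e by apply: mulr_ge0 => //; rewrite !mulr_ge0 ?addr_ge0.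
have deltaE : deltaG d s h = a + e by [].
have p1 : 0 <= 4 * (c4 + 1) * g by rewrite !mulr_ge0 ?addr_ge0.
have p2 : 0 <= 2 * M ^+ 2 * c6 by apply: mulr_ge0 => //; apply: mulr_ge0.
have b1 : 4 * t * G2 * (D ^+ 2 * c4 + 1) <= a * (4 * (c4 + 1) * g).
  have -> : 4 * t * G2 * (D ^+ 2 * c4 + 1) =
    (4 * t) * ((D ^+ 2 * c4 + 1) * G2) by ring.
  have -> : a * (4 * (c4 + 1) * g) = (4 * t) * ((D * (D + 2) * (c4 + 1)) * g).
    by rewrite /a; ring.
  rewrite ler_wpM2l ?mulr_ge0// ler_pM// ?addr_ge0 ?mulr_ge0 ?exprn_ge0//.
  have : 0 <= D * c4 by rewrite mulr_ge0.
  nra.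
have b2 : 2 * M ^+ 2 * h ^+ 2 * D ^+ 3 * c6 <= e * (2 * M ^+ 2 * c6).
  have -> : 2 * M ^+ 2 * h ^+ 2 * D ^+ 3 * c6 =
    (D ^+ 3 * h ^+ 2) * (2 * M ^+ 2 * c6) by ring.
  rewrite ler_wpM2r// ler_wpM2r//.
  have : 0 <= D ^+ 2 by exact: sqr_ge0.
  nra.
(* The two mixed products of the expanded right-hand side are nonnegative and are dropped. *)
rewrite deltaE; have := mulr_ge0 a0 p2; have := mulr_ge0 e0 p1.
lra.
Qed.

(** The order of the quantifiers expresses uniformity: the constants are fixed before the dimension,
    the sample size, [h], the function and the probability space. *)
Theorem lemma4p4 (R : realType) (M m b : R) (hm : 0 < m) (hb : 0 < b) :
  exists PG QG : R,
    forall (d s : nat) (h : R) (F : 'rV[R]_d -> R)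
      (disp : measure_display) (Omega : measurableType disp)
      (P : probability Omega R) (u : 'I_s -> Omega -> 'rV[R]_d),
      (0 < d)%N -> (0 < s)%N -> 0 < h -> h <= 1 ->
      smooth M F -> dissipative m b F ->
      (forall i, std_gaussian P (u i)) -> independent_vectors P u ->
      (forall x,
         (grad_error P F (zo_estimator F h u) x
            <= (deltaG d s h * (PG * enorm x ^+ 2 + QG))%:E)%E)
      /\ controlled_growth P F (zo_estimator F h u) (deltaG d s h) PG QG.
Proof.
pose c4 := normal_moment R 4; pose c6 := normal_moment R 6.
have c40 : 0 <= c4 by exact: normal_moment_ge0.
have c60 : 0 <= c6 by exact: normal_moment_ge0.
(* These are the coefficients of [4 (c4 + 1) g + 2 M^2 c6] when [g] is the bound
   [2 M^2 |x|^2 + 2 (M + b)^2] on the squared gradient. *)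
exists (8 * (c4 + 1) * M ^+ 2), (8 * (c4 + 1) * (M + b) ^+ 2 + 2 * M ^+ 2 * c6).
move=> d s h F disp Omega P u d0 s0 h0 _ sF disF gu indu.
have bound x : (grad_error P F (zo_estimator F h u) x <=
    (deltaG d s h * (8 * (c4 + 1) * M ^+ 2 * enorm x ^+ 2 +
      (8 * (c4 + 1) * (M + b) ^+ 2 + 2 * M ^+ 2 * c6)))%:E)%E.
  apply: le_trans (grad_error_zo_le gu indu x s0 h0 sF) _; rewrite lee_fin.
  have := growth_constants_le s h M d0 c40 c60 (dotp_ge0 (grad F x))
    (grad_le x hm hb sF disF).
  by move/le_trans; apply; rewrite le_eqVlt; apply/orP; left; apply/eqP; ring.
split; first exact: bound.
split; last exact: bound.
- exact: deltaG_gt0.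
- by apply: mulr_ge0; rewrite ?sqr_ge0// mulr_ge0 ?addr_ge0.
- apply: addr_ge0; last by apply: mulr_ge0 => //; rewrite mulr_ge0 ?sqr_ge0.
  by apply: mulr_ge0; rewrite ?sqr_ge0// mulr_ge0 ?addr_ge0.
Qed.
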